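(* Let $\mathbf B\in\mathcal{SB}(\mathbb C^J)$. The following conditions are equivalent: (i) $\mathfrak h(\mathbf B)=0$; (ii) $\mathbf B\in M$.
   Context: Let $J\ge1$ and $\mu=(\mu_0,\dots,\mu_{J-1})$ with all $\mu_j>0$. $\mathcal{SB}(\mathbb C^J)$ is the set of $J\times J$ matrices with nonnegative entries and all row sums and column sums at most $1$. For $\mathbf B\in\mathcal{SB}(\mathbb C^J)$, $\mathcal P_{\mathrm{Ker}(\mathbf B-I)}$ is the projection of $\mathbb C^J$ onto $\mathrm{Ker}(\mathbf B-I)$ along $\mathrm{Im}(\mathbf B-I)$ (these are complementary), $\mathcal P^T$ is its transpose, $e=(1,\dots,1)$, $0\log0=0$, and $$\mathfrak h(\mathbf B)=-\sum_{j,k=0}^{J-1}\big(\mathcal P^T_{\mathrm{Ker}(\mathbf B-I)}e\big)_j\,\mathbf B_{jk}\,\big(\mathcal P_{\mathrm{Ker}(\mathbf B-I)}\mu\big)_k\log\mathbf B_{jk}.$$ Let $\mathbf j(\mathbf B)\subset\{0,\dots,J-1\}$ be the set of all indices $j$ such that $u_j=0$ for every $u\in\mathrm{Ker}(\mathbf B^T-I)$, and $\mathbf k(\mathbf B)\subset\{0,\dots,J-1\}$ the set of all indices $k$ such that $v_k=0$ for every $v\in\mathrm{Ker}(\mathbf B-I)$. Define $$M=\big\{\mathbf B\in\mathcal{SB}(\mathbb C^J):\ \mathbf B_{at}\in\{0,1\}\text{ and }\mathbf B_{tb}\in\{0,1\}\text{ for all }a\notin\mathbf j(\mathbf B),\ b\notin\mathbf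 k(\mathbf B),\ t\in\{0,\dots,J-1\}\big\}.$$ *)

(* Defs.v *)
From HB Require Import structures.
From mathcomp Require Export all_boot all_order all_algebra.
From mathcomp Require Export complex.
From mathcomp Require Export classical_sets reals exp.

Set Implicit Arguments.
Unset Strict Implicit.
Unset Printing Implicit Defensive.

Import Order.TTheory GRing.Theory Num.Theory.
Local Open Scope ring_scope.
Local Open Scope complex_scope.
Local Open Scope classical_set_scope.

Section Kernel.
Variables (F : fieldType) (n : nat).

(* Matrices act on column vectors here, whereas kermx and proj_mx use the
   row-vector convention; hence the transpositions in Ker_proj. *)
Definition Ker (A : 'M[F]_n) : set 'cV[F]_n := [set v | A *m v = 0].

(* The projection onto Ker A along Im A, when these are complementary. *)
Definition Ker_proj (A : 'M[F]_n) : 'M[F]_n := (proj_mx (kermx A^T) A^T)^T.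

Lemma Ker_proj_id (A : 'M[F]_n) (v : 'cV[F]_n) :
  (kermx A^T :&: A^T = 0)%MS -> Ker A v -> Ker_proj A *m v = v.
Proof.
move=> dxA Av; apply: trmx_inj; rewrite trmx_mul trmxK proj_mx_id //.
by apply/sub_kermxP; rewrite -trmx_mul Av trmx0.
Qed.

Lemma Ker_proj_Im (A : 'M[F]_n) (w : 'cV[F]_n) :
  (kermx A^T :&: A^T = 0)%MS -> Ker_proj A *m (A *m w) = 0.
Proof.
move=> dxA; apply: trmx_inj; rewrite trmx_mul trmxK trmx0 proj_mx_0 //.
by rewrite trmx_mul submxMl.
Qed.

End Kernel.

Section Substochastic.
Variables (R : realType) (J : nat).
Implicit Types (B : 'M[R]_J) (mu : 'cV[R]_J).

Definition SB : set 'M[R]_J :=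
  [set B | [/\ forall j k, 0 <= B j k,
               forall j, \sum_k B j k <= 1
             & forall k, \sum_j B j k <= 1]].

Definition complexify m n (A : 'M[R]_(m, n)) : 'M[R[i]]_(m, n) :=
  map_mx (real_complex R) A.

(* The operator B - I on C^J. *)
Definition subI B : 'M[R[i]]_J := complexify B - 1%:M.

(* The convention 0 log 0 = 0 holds because ln 0 = 0. *)
Definition entropy mu B : R[i] :=
  let P := Ker_proj (subI B) in
  - \sum_(j < J) \sum_(k < J)
      (P^T *m const_mx 1 : 'cV_J) j 0 * (B j k)%:C
      * (P *m complexify mu) k 0 * (ln (B j k))%:C.

Definition jset B : set 'I_J :=
  [set j | forall u : 'cV[R[i]]_J, Ker (complexify B^T - 1%:M) u -> u j 0 = 0].

Definition kset B : set 'I_J :=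
  [set k | forall v : 'cV[R[i]]_J, Ker (subI B) v -> v k 0 = 0].

Definition Mset : set 'M[R]_J :=
  [set B | SB B /\
    forall a b t : 'I_J, ~ jset B a -> ~ kset B b ->
      (B a t = 0 \/ B a t = 1) /\ (B t b = 0 \/ B t b = 1)].

End Substochastic.

Arguments SB : clear implicits.
Arguments Mset : clear implicits.

(* Main.v *)
(** A fixed vector [u] of a doubly substochastic matrix [B] satisfies
    [sum_jk B_jk |u_j - u_k|^2 + sum_j (1 - r_j) |u_j|^2
       + sum_k (1 - c_k) |u_k|^2 = 0],
    where [r] and [c] are the row and column sums.  Hence [u] is constant along
    the nonzero entries of [B] and supported where [r = c = 1].  This condition
    is invariant under transposition and under entrywise functions fixing 0, so
    [Ker (B - I) = Ker (B^T - I)] and the projection onto it is orthogonal.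
    Testing orthogonality on indicators of level sets shows that the projection
    of a positive vector is nonnegative with the largest possible support.  All
    terms of the entropy therefore have the same sign. *)
Require Import Defs.
From mathcomp Require Import ring.

Set Implicit Arguments.
Unset Strict Implicit.

Import Order.TTheory GRing.Theory Num.Theory.
Local Open Scope ring_scope.
Local Open Scope classical_set_scope.

(** * Fixed vectors of doubly substochastic matrices *)

Section DoublySubstochastic.
Variables (C : numClosedFieldType) (n : nat).
Implicit Types (B : 'M[C]_n) (u v w mu : 'cV[C]_n).

Definition substochastic B :=
  [/\ forall j k, 0 <= B j k,
      forall j, \sum_k B j k <= 1
    & forall k, \sum_j B j k <= 1].

Definition balanced B u :=
  (forall j k, B j k != 0 -> u j 0 = u k 0) /\
  (forall j, u j 0 != 0 -> \sum_k B j k = 1 /\ \sum_k B k j = 1).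

Lemma substochastic_tr B : substochastic B -> substochastic B^T.
Proof.
move=> [B0 Br Bc]; split=> [j k|j|k]; first by rewrite mxE.
  by under eq_bigr do rewrite mxE; exact: Bc.
by under eq_bigr do rewrite mxE; exact: Br.
Qed.

Lemma balanced_tr B u : balanced B u -> balanced B^T u.
Proof.
move=> [uB usum]; split=> [j k|j /usum[r1 c1]].
  by rewrite mxE => /uB.
by split; [rewrite -[RHS]c1 | rewrite -[RHS]r1]; apply: eq_bigr => k _;
  rewrite mxE.
Qed.

(** Supplies the test vectors used below: conjugates, indicators of level sets, and indicators of
    the zero set of one fixed vector within the support of another. The condition [f 0 0 = 0] keeps
    the support inside the union of the two given ones. *)
Lemma balanced_map2 B u v (f : C -> C -> C) : f 0 0 = 0 ->
  balanced B u -> balanced B v -> balanced B (\col_j f (u j 0) (v j 0)).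
Proof.
move=> f0 [uB usum] [vB vsum]; split=> [j k Bjk|j].
  by rewrite !mxE (uB _ _ Bjk) (vB _ _ Bjk).
rewrite mxE; have [-> |/usum//] := eqVneq (u j 0) 0.
by have [-> |/vsum//] := eqVneq (v j 0) 0; rewrite f0 eqxx.
Qed.

(** When the squares are expanded, the cross terms of row [j] add up to [2 |u_j|^2], since [B] is
    real and so fixes both [u] and its conjugate. The remaining terms carry row and column sums and
    cancel against the two defect sums. *)
Lemma dirichlet_form B u : substochastic B -> B *m u = u ->
  \sum_j \sum_k B j k * `|u j 0 - u k 0| ^+ 2
  + (\sum_j (1 - \sum_k B j k) * `|u j 0| ^+ 2
     + \sum_k (1 - \sum_j B j k) * `|u k 0| ^+ 2) = 0.
Proof.
move=> [B0 _ _] Bu.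
have Bu_ j : \sum_k B j k * u k 0 = u j 0 by rewrite -[in RHS]Bu mxE.
have Buc j : \sum_k B j k * (u k 0)^* = (u j 0)^*.
  rewrite -[in RHS]Bu_ rmorph_sum; apply: eq_bigr => k _.
  by rewrite rmorphM /= (CrealP (ger0_real (B0 j k))).
have -> : \sum_j \sum_k B j k * `|u j 0 - u k 0| ^+ 2 =
    \sum_j (\sum_k B j k) * `|u j 0| ^+ 2
    + \sum_j \sum_k B j k * `|u k 0| ^+ 2 - \sum_j `|u j 0| ^+ 2 *+ 2.
  rewrite -big_split -sumrB; apply: eq_bigr => j _ /=.
  have -> : `|u j 0| ^+ 2 *+ 2 =
      u j 0 * (\sum_k B j k * (u k 0)^* )
      + (u j 0)^* * (\sum_k B j k * u k 0).
    by rewrite Buc Bu_ normCK mulr2n [X in _ + X]mulrC.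
  rewrite mulr_suml !mulr_sumr -!big_split -sumrB; apply: eq_bigr => k _ /=.
  by rewrite !normCK rmorphB; ring.
rewrite [X in _ + X - _]exchange_big /=.
under [X in _ + X - _]eq_bigr do rewrite -mulr_suml.
rewrite -big_split -sumrB -!big_split /= big1 // => j _.
by ring.
Qed.

Lemma fixed_balanced B u : substochastic B -> B *m u = u -> balanced B u.
Proof.
move=> sB Bu; have := dirichlet_form sB Bu; case: sB => B0 Br Bc.
have D0 j k : 0 <= B j k * `|u j 0 - u k 0| ^+ 2.
  by rewrite mulr_ge0 ?exprn_ge0.
have r0 j : 0 <= (1 - \sum_k B j k) * `|u j 0| ^+ 2.
  by rewrite mulr_ge0 ?exprn_ge0 ?subr_ge0.
have c0 k : 0 <= (1 - \sum_j B j k) * `|u k 0| ^+ 2.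
  by rewrite mulr_ge0 ?exprn_ge0 ?subr_ge0.
move/eqP; rewrite !paddr_eq0 ?addr_ge0 ?sumr_ge0 //; last first.
  by move=> j _; rewrite sumr_ge0.
rewrite !psumr_eq0 //; last by move=> j _; rewrite sumr_ge0.
move=> /and3P[/allP D /allP r /allP c]; split=> [j k Bjk|j uj].
  have := D j (mem_index_enum _); rewrite /= psumr_eq0 // => /allP.
  move=> /(_ k (mem_index_enum _)) /=.
  by rewrite mulf_eq0 (negbTE Bjk) /= sqrf_eq0 normr_eq0 subr_eq0 => /eqP.
have {}r := r j (mem_index_enum _); have {}c := c j (mem_index_enum _).
move: r c; rewrite /= !mulf_eq0 !normr_eq0 (negbTE uj) !orbF !subr_eq0.
by move=> /eqP <- /eqP <-.
Qed.

Lemma balanced_fixed B u : balanced B u -> B *m u = u.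
Proof.
move=> [uB usum]; apply/colP => j; rewrite mxE.
have -> : \sum_k B j k * u k 0 = (\sum_k B j k) * u j 0.
  rewrite mulr_suml; apply: eq_bigr => k _.
  by have [-> |/uB->//] := eqVneq (B j k) 0; rewrite !mul0r.
by have [-> |/usum[-> _]] := eqVneq (u j 0) 0; rewrite ?mulr0 ?mul1r.
Qed.

Lemma Ker_balanced B u :
  substochastic B -> Ker (B - 1%:M) u <-> balanced B u.
Proof.
move=> sB; rewrite /Ker /= mulmxBl mul1mx; split.
  by move/eqP; rewrite subr_eq0 => /eqP; apply: fixed_balanced.
by move/balanced_fixed->; rewrite subrr.
Qed.

Lemma Ker_tr B u : substochastic B ->
  Ker (B^T - 1%:M) u <-> Ker (B - 1%:M) u.
Proof.
move=> sB; split=> [/(Ker_balanced _ (substochastic_tr sB)) /balanced_tr|].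
  by rewrite trmxK => /(Ker_balanced _ sB).
by move=> /(Ker_balanced _ sB) /balanced_tr /(Ker_balanced _ (substochastic_tr sB)).
Qed.

(** * The projection onto the fixed space *)

Section Projection.
Variable B : 'M[C]_n.
Hypothesis sB : substochastic B.
Let A := B - 1%:M.

Let trA : A^T = B^T - 1%:M.
Proof. by rewrite /A linearB /= trmx1. Qed.

Let KerA_tr m (W : 'M[C]_(n, m)) : A *m W = 0 -> A^T *m W = 0.
Proof.
move=> AW; apply/trmx_inj/row_matrixP => j; rewrite -!tr_col; congr trmx.
rewrite col0 colE -mulmxA trA.
by apply/(Ker_tr _ sB); rewrite /Ker /= mulmxA AW mul0mx.
Qed.

(** For [v = x A^T] in the kernel, the conjugate of [v] is balanced too, hence killed by [A^T]. Thus
    the squared norm of [v] is [x] times zero. *)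
Lemma Ker_Im_trivial : (kermx A^T :&: A^T = 0)%MS.
Proof.
apply/eqP/rowV0P => v; rewrite sub_capmx => /andP[/sub_kermxP vA /submxP[x vx]].
have /(Ker_balanced _ sB) bv : Ker A v^T.
  by rewrite /Ker /= -[A]trmxK -trmx_mul vA trmx0.
have Aw : A^T *m \col_j ((v^T) j 0)^* = 0.
  apply/KerA_tr/(Ker_balanced _ sB).
  exact: (balanced_map2 (f := fun x _ => x^* ) (rmorph0 _) bv bv).
have : v *m \col_j ((v^T) j 0)^* = 0 by rewrite [X in X *m _]vx -mulmxA Aw mulmx0.
move=> /matrixP/(_ 0 0); rewrite !mxE => /eqP.
under eq_bigr do rewrite !mxE -normCK.
rewrite psumr_eq0 => [/allP v0|j _]; last exact: exprn_ge0.
apply/rowP => j; have := v0 j (mem_index_enum _).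
by rewrite /= sqrf_eq0 normr_eq0 mxE => /eqP.
Qed.

Lemma Ker_Im_full : row_full (kermx A^T + A^T)%MS.
Proof.
have /mxdirect_addsP/mxdirectP/= r := Ker_Im_trivial.
by rewrite /row_full r mxrank_ker subnK ?rank_leq_row.
Qed.

Lemma Ker_proj_sub : A *m Ker_proj A = 0.
Proof.
apply: trmx_inj; rewrite trmx_mul trmxK trmx0; apply/sub_kermxP.
by rewrite -[proj_mx _ _]mul1mx proj_mx_sub.
Qed.

(** The rows of [1 - (Ker_proj A)^T] lie in the row space of [A^T], and [A^T] also kills [W]. *)
Lemma Ker_proj_orth m (W : 'M[C]_(n, m)) : A *m W = 0 -> W^T *m Ker_proj A = W^T.
Proof.
move=> /KerA_tr AW.
have /submxP[x vx] := proj_mx_compl_sub (submx_full 1%:M Ker_Im_full).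
apply: trmx_inj; rewrite trmx_mul !trmxK; apply/eqP.
by rewrite eq_sym -subr_eq0 -[X in X - _]mul1mx -[proj_mx _ _]mul1mx -mulmxBl
  vx -mulmxA AW mulmx0.
Qed.

(** Taking [W] to be the projection [P] itself gives [P^T P = P^T], whose left side is symmetric. *)
Lemma Ker_proj_sym : (Ker_proj A)^T = Ker_proj A.
Proof.
have PP := Ker_proj_orth Ker_proj_sub.
by have := congr1 trmx PP; rewrite trmx_mul !(trmxK (Ker_proj A)) PP.
Qed.

Lemma Ker_proj_balanced mu : balanced B (Ker_proj A *m mu).
Proof. by apply/(Ker_balanced _ sB); rewrite /Ker /= mulmxA Ker_proj_sub mul0mx. Qed.

Lemma sum_Ker_proj mu w : balanced B w ->
  \sum_j w j 0 * (Ker_proj A *m mu) j 0 = \sum_j w j 0 * mu j 0.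
Proof.
move=> /(Ker_balanced _ sB) /Ker_proj_orth wP.
have /matrixP/(_ 0 0) : w^T *m (Ker_proj A *m mu) = w^T *m mu.
  by rewrite mulmxA wP.
by rewrite !mxE; under eq_bigr do rewrite mxE; under [RHS]eq_bigr do rewrite mxE.
Qed.

Variable mu : 'cV[C]_n.
Hypothesis mu_gt0 : forall j, 0 < mu j 0.
Let p := Ker_proj A *m mu.

(* At a nonzero value [c] of [p], orthogonality to the indicator of the level
   set [p = c] says that [c] is the mean of [mu] over that level set. *)
Lemma Ker_proj_ge0 j : 0 <= p j 0.
Proof.
have [-> //|pj0] := eqVneq (p j 0) 0.
pose f (x _ : C) : C := ((x == p j 0)%:R : C).
have f0 : f 0 0 = 0 by rewrite /f eq_sym (negbTE pj0).
have bp : balanced B p by exact: Ker_proj_balanced.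
have := sum_Ker_proj mu (balanced_map2 f0 bp bp).
set w := \col_j _ => Ew.
have w0 i : 0 <= w i 0 by rewrite mxE /f ler0n.
have wj : 0 < \sum_i w i 0.
  rewrite lt0r sumr_ge0 // andbT psumr_neq0 //.
  by apply/hasP; exists j; rewrite ?mem_index_enum //= mxE /f eqxx ltr01.
rewrite -(pmulr_rge0 _ wj).
suff -> : (\sum_i w i 0) * p j 0 = \sum_i w i 0 * mu i 0.
  by rewrite sumr_ge0 // => i _; rewrite mulr_ge0 // ltW.
rewrite -Ew mulr_suml; apply: eq_bigr => i _; rewrite mxE /f -/p.
by have [->|] := eqVneq (p i 0) (p j 0); rewrite ?mul0r.
Qed.

Lemma Ker_proj_eq0 j : p j 0 = 0 <-> forall v, Ker A v -> v j 0 = 0.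
Proof.
split=> [pj0 v /(Ker_balanced _ sB) bv|]; last first.
  by apply; apply/(Ker_balanced _ sB)/Ker_proj_balanced.
apply/eqP; apply: contraT => vj0.
(* The indicator of the set where [p] vanishes but [v] does not is orthogonal to [p], hence to [mu];
   as [mu] is positive, this set is empty. *)
pose f (x y : C) : C := (((x == 0) && (y != 0))%:R : C).
have f0 : f 0 0 = 0 by rewrite /f eqxx.
have bp : balanced B p by exact: Ker_proj_balanced.
have := sum_Ker_proj mu (balanced_map2 f0 bp bv).
rewrite big1 => [/esym/eqP|i _]; last first.
  by rewrite mxE /f -/p; have [->|] := eqVneq (p i 0) 0; rewrite ?mulr0 ?mul0r.
rewrite psumr_eq0 => [/allP/(_ j (mem_index_enum _))|i _].
  by rewrite /= mxE /f pj0 eqxx vj0 mul1r (gt_eqF (mu_gt0 j)).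
by rewrite mxE /f mulr_ge0 ?ler0n ?ltW.
Qed.

Lemma Ker_proj_link j k : B j k != 0 -> p j 0 = p k 0.
Proof. by case: (Ker_proj_balanced mu) => + _; apply. Qed.

End Projection.
End DoublySubstochastic.

(** * The entropy of a real matrix *)

Lemma substochastic_complexify (R : realType) (J : nat) (B : 'M[R]_J) :
  SB R J B -> substochastic (complexify B).
Proof.
move=> [B0 Br Bc]; split=> [j k|j|k]; first by rewrite mxE ler0c.
  under eq_bigr do rewrite mxE.
  by rewrite -rmorph_sum -[1](rmorph1 (real_complex R)) lecR.
under eq_bigr do rewrite mxE.
by rewrite -rmorph_sum -[1](rmorph1 (real_complex R)) lecR.
Qed.

Lemma SB_entry_le1 (R : realType) (J : nat) (B : 'M[R]_J) j k :
  SB R J B -> B j k <= 1.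
Proof.
move=> [B0 Br _]; apply: le_trans (Br j).
by rewrite (bigD1 k) //= lerDl sumr_ge0.
Qed.

Lemma mul_ln_eq0 (R : realType) (x : R) : 0 <= x ->
  (x * ln x == 0) = (x == 0) || (x == 1).
Proof.
rewrite le0r => /predU1P[->|x0]; first by rewrite mul0r !eqxx.
by rewrite mulf_eq0 ln_eq0.
Qed.

Theorem lemma7p3 (R : realType) (J : nat) (hJ : (1 <= J)%N)
    (mu : 'cV[R]_J) (mu_gt0 : forall j : 'I_J, 0 < mu j 0)
    (B : 'M[R]_J) (hB : SB R J B) :
  entropy mu B = 0 <-> Mset R J B.
Proof.
have sB := substochastic_complexify hB.
(* The transpose in the entropy weights is dropped, by symmetry of the projection. *)
pose a j := (Ker_proj (subI B) *m const_mx 1 : 'cV_J) j 0.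
pose b k := (Ker_proj (subI B) *m complexify mu) k 0.
have e0 j : 0 < (const_mx 1 : 'cV[R[i]]_J) j 0 by rewrite mxE ltr01.
have m0 j : 0 < complexify mu j 0 by rewrite mxE -(rmorph0 (real_complex R)) ltcR.
have a0 j : 0 <= a j by exact: Ker_proj_ge0.
have b0 k : 0 <= b k by exact: Ker_proj_ge0.
have Kset k : kset B k <-> b k = 0.
  by apply: iff_sym; exact: Ker_proj_eq0.
have Kset_a k : kset B k <-> a k = 0.
  by apply: iff_sym; exact: Ker_proj_eq0.
have Jset j : jset B j <-> kset B j.
  rewrite /jset /kset /= /complexify -map_trmx.
  by split=> uj u /(Ker_tr _ sB) Ku; exact: uj.
have link j k : B j k != 0 -> kset B j <-> kset B k.
  move=> Bjk; rewrite !Kset; suff -> : b j = b k by [].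
  apply: (Ker_proj_link sB); rewrite mxE.
  by rewrite -(rmorph0 (real_complex R)) (inj_eq (@complexI _)).
have [B0 _ _] := hB.
pose t j k := a j * b k * (real_complex R (- (B j k * ln (B j k)))).
have t0 j k : 0 <= t j k.
  rewrite mulr_ge0 ?mulr_ge0 // ler0c oppr_ge0 mulr_ge0_le0 // ln_le0 //.
  exact: SB_entry_le1.
have -> : entropy mu B = \sum_j \sum_k t j k.
  rewrite /entropy (Ker_proj_sym sB) -sumrN; apply: eq_bigr => j _.
  rewrite -sumrN; apply: eq_bigr => k _.
  by rewrite /t /a /b rmorphN rmorphM /=; ring.
have E : \sum_j \sum_k t j k = 0 <->
    forall j k, a j != 0 -> b k != 0 -> B j k = 0 \/ B j k = 1.
  split=> [/psumr_eq0P sum0 j k aj bk | Bjk].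
    have tjk : t j k = 0.
      apply: (psumr_eq0P _ (sum0 _ j isT)) => // i _.
      by rewrite sumr_ge0.
    move: tjk => /eqP.
    rewrite !mulf_eq0 (negbTE aj) (negbTE bk) /=.
    rewrite -(rmorph0 (real_complex R)) (inj_eq (@complexI _)) oppr_eq0.
    by rewrite mul_ln_eq0 // => /orP[]/eqP; [left|right].
  rewrite big1 // => j _; rewrite big1 // => k _; rewrite /t.
  have [->|aj] := eqVneq (a j) 0; first by rewrite !mul0r.
  have [->|bk] := eqVneq (b k) 0; first by rewrite mulr0 mul0r.
  have /eqP -> : B j k * ln (B j k) == 0.
    by rewrite mul_ln_eq0 //; case: (Bjk j k aj bk) => ->; rewrite eqxx ?orbT.
  by rewrite oppr0 rmorph0 mulr0.
have aP j : a j != 0 <-> ~ kset B j by rewrite Kset_a; split=> /eqP.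
have bP j : b j != 0 <-> ~ kset B j by rewrite Kset; split=> /eqP.
rewrite E; split=> [Bjk | [_ M] j k /aP aj /bP bk]; last first.
  (* The choice [t = k] suffices here. *)
  by have [] := M j k k (fun h => aj ((Jset _).1 h)) bk.
split=> // x y z jx ky; split.
  (* Here [z] is arbitrary, but a nonzero entry [B x z] forces [z] outside [kset B] along with [x],
     so [Bjk] applies. *)
  have [->|Bxz] := eqVneq (B x z) 0; first by left.
  have kx : ~ kset B x by move=> /Jset.
  by apply: Bjk; [exact/aP | apply/bP => /(link _ _ Bxz)].
have [->|Bzy] := eqVneq (B z y) 0; first by left.
by apply: Bjk; [apply/aP => /(link _ _ Bzy) | exact/bP].
Qed.
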